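(* Let $\mathbf{u}$ be a fixed point of a primitive morphism over a binary alphabet. Then there is a constant $K>0$ such that either $\mathrm{PL}_{\mathbf{u}}(n)\le K\ln n$ for all integers $n\ge 2$, or $\mathrm{PL}_{\mathbf{u}}(n)\ge Kn$ for all integers $n\ge 1$.
   Context: A palindrome is a word equal to its reversal. For a finite word $w$, $\operatorname{pal}(w)$ is the minimal number of palindromes whose concatenation is $w$. For an infinite word $\mathbf{u}$, $\mathrm{PL}_{\mathbf{u}}(n)=\max\{\operatorname{pal}(w): w \text{ a factor of } \mathbf{u},\ |w|=n\}$. A morphism $\varphi$ of $A^*$ is primitive if some power $\varphi^K$ maps every letter to a word containing every letter; $\mathbf{u}$ is a fixed point if $\varphi(\mathbf{u})=\mathbf{u}$. *)

(* Defs.v *)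
From mathcomp Require Import all_boot all_order all_algebra.
From mathcomp Require Import all_classical all_reals all_analysis.

Set Implicit Arguments.
Unset Strict Implicit.
Unset Printing Implicit Defensive.

Section Words.
Variable A : finType.

Definition palindrome (w : seq A) : bool := rev w == w.

Definition pal_factorization (w : seq A) (k : nat) : Prop :=
  exists s : seq (seq A), [/\ all palindrome s, flatten s = w & size s = k].

Lemma pal_factorization_ex (w : seq A) :
  exists k : nat, `[< pal_factorization w k >].
Proof.
exists (size w); apply/asboolP; exists [seq [:: a] | a <- w]; split.
- by rewrite all_map; apply/allP => a _ /=; apply/eqP.
- by elim: w => //= a w ->.
- by rewrite size_map.
Qed.

Definition pal (w : seq A) : nat := ex_minn (pal_factorization_ex w).

Definition subword (u : nat -> A) (i n : nat) : seq A :=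
  mkseq (fun j => u (i + j)) n.

Definition factor (u : nat -> A) (w : seq A) : Prop :=
  exists i : nat, w = subword u i (size w).

(* The index set is finite and, for every n, contains a factor of u, so this
   is a maximum over a nonempty set. *)
Definition PL (u : nat -> A) (n : nat) : nat :=
  \max_(w : n.-tuple A | `[< factor u w >]) pal w.

(* Preservation of the empty word follows, since seq A is cancellative. *)
Definition word_morphism (phi : seq A -> seq A) : Prop :=
  {morph phi : s t / s ++ t}.

Definition primitive_morphism (phi : seq A -> seq A) : Prop :=
  word_morphism phi /\
  exists2 K : nat, 0 < K & forall a b : A, b \in iter K phi [:: a].

(* v is the infinite concatenation phi(u_0) phi(u_1) phi(u_2) ... ; the second
   clause says that this concatenation is indeed infinite. *)
Definition infinite_image (phi : seq A -> seq A) (u v : nat -> A) : Prop :=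
  (forall n, let w := phi (subword u 0 n) in w = subword v 0 (size w)) /\
  (forall m, exists n, m <= size (phi (subword u 0 n))).

Definition fixed_point (phi : seq A -> seq A) (u : nat -> A) : Prop :=
  infinite_image phi u u.

End Words.

(* Main.v *)
Require Import Defs.
From mathcomp Require Import all_boot all_order all_algebra.
From mathcomp Require Import all_classical all_reals all_analysis.
From mathcomp Require Import zify.

(**
If the palindromic factors of [u] have bounded length, the palindromic length is
clearly linear. Suppose they are unbounded. If [u] is periodic, its palindromic
length is bounded. Otherwise let [tau] be a power of the morphism. The images of
the two letters under [tau] do not commute, so [tau] is conjugate to a morphism
whose two letter images start with different letters, and the square [G] of that
morphism sends each letter [c] to a word starting with [c]. The same applied to
the mirror image of [tau] gives a morphism [H] conjugate to the mirror image of
[tau^2], with the same property. A long palindrome in [u] is parsed by both [G]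
and [H]. If [G c <> H c] for some letter [c], the two parsings, run in parallel,
are deterministic, so [u] has arbitrarily long factors of bounded period and is
periodic by recurrence. Hence [G = H], so [tau^2 c] is conjugate to its reversal
and is a product of two palindromes. Since a factor of length [n] is a product of
[O(log n)] images of letters under powers of the morphism, the bound follows.
*)

Set Implicit Arguments.
Unset Strict Implicit.
Unset Printing Implicit Defensive.

(** * Palindromic length: subadditivity and invariance under reversal *)

Section PalLength.
Variable A : finType.
Implicit Types w x y z : seq A.

Lemma palP w : pal_factorization w (pal w).
Proof. by rewrite /pal; case: ex_minnP => m /asboolP. Qed.

Lemma pal_min w k : pal_factorization w k -> pal w <= k.
Proof. by move=> h; rewrite /pal; case: ex_minnP => m _; apply; apply/asboolP. Qed.

Lemma pal_cat x y : pal (x ++ y) <= pal x + pal y.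
Proof.
have [s [s1 s2 s3]] := palP x; have [t [t1 t2 t3]] := palP y.
apply: pal_min; exists (s ++ t); split.
- by rewrite all_cat s1.
- by rewrite flatten_cat s2 t2.
- by rewrite size_cat s3 t3.
Qed.

Lemma pal_size w : pal w <= size w.
Proof.
apply: pal_min; exists [seq [:: a] | a <- w]; split.
- by rewrite all_map; apply/allP => a _ /=; apply/eqP.
- by elim: w => //= a w ->.
- by rewrite size_map.
Qed.

Lemma pal_palindrome w : palindrome w -> pal w <= 1.
Proof. by move=> h; apply: pal_min; exists [:: w]; rewrite /= h cats0. Qed.

Lemma pal_rev w : pal (rev w) = pal w.
Proof.
suff le x : pal (rev x) <= pal x.
  by apply/eqP; rewrite eqn_leq le /= -{1}(revK w) le.
have [s [s1 s2 s3]] := palP x; apply: pal_min; exists (rev s); split.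
- by rewrite all_rev.
- rewrite -s2; elim: s s1 {s2 s3} => //= p s IH /andP[/eqP pp /IH {}IH].
  by rewrite rev_cons flatten_rcons IH rev_cat pp.
- by rewrite size_rev.
Qed.

End PalLength.

(** * Conjugate words and products of two palindromes *)

Section Conjugacy.
Variable T : eqType.
Implicit Types w x y z : seq T.

(** If [z] is longer than [x], it starts with [x], which can be stripped from it without changing
    the equation. Once [z] is no longer than [x], it is a prefix of [x], and rotating by its length
    gives [y]. *)
Lemma conj_rot x y z : x ++ z = z ++ y -> exists2 k, k <= size x & y = rot k x.
Proof.
have [n] := ubnP (size z); elim: n z => // n IH z zn E.
have sxy : size x = size y.
  by move: (congr1 size E); rewrite !size_cat addnC; lia.
have [le|lt] := leqP (size z) (size x).
  exists (size z) => //.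
  have tz : take (size z) x = z.
    move: (congr1 (take (size z)) E); rewrite take_cat take_size_cat //.
    rewrite ltn_neqAle le andbT.
    by case: eqP => // ->; rewrite subnn take0 cats0 take_size.
  move: E; rewrite -{1}(cat_take_drop (size z) x) tz -catA => /eqP.
  rewrite eqseq_cat // eqxx /= => /eqP <-.
  by rewrite /rot tz.
case: x sxy lt E IH => [|c x'] sxy lt E IH.
  by exists 0 => //; rewrite rot0; apply/nilP; rewrite /nilp -sxy.
set x := c :: x' in sxy lt E IH *.
have dz : z = x ++ drop (size x) z.
  move: (congr1 (take (size x)) E).
  by rewrite take_size_cat // take_cat lt => {1}->; rewrite cat_take_drop.
apply: (IH (drop (size x) z)).
  by rewrite size_drop; move: lt zn; rewrite /x /=; lia.
move: E; rewrite {1 2}dz -catA => /eqP.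
by rewrite eqseq_cat // eqxx /= => /eqP.
Qed.

(** Both sides split into pieces of the same lengths, so each piece equals its own reversal. *)
Lemma rot_rev_split x m : rot m x = rev x ->
  rev (take m x) = take m x /\ rev (drop m x) = drop m x.
Proof.
rewrite -{2}(cat_take_drop m x) rev_cat /rot => /eqP.
rewrite eqseq_cat ?size_rev // => /andP[/eqP h1 /eqP h2].
by split; symmetry.
Qed.

Lemma conj_common_rot x y g z z' : x ++ z = z ++ g -> y ++ z' = z' ++ g ->
  exists m, rot m x = y.
Proof.
move=> /conj_rot[k1 k1x ->] /conj_rot[k2 k2y /(congr1 (rotr k2))].
rewrite rotK => <-; rewrite /rotr size_rot rot_add_mod ?leq_subr //.
by eexists.
Qed.

End Conjugacy.

(** The common conjugate [g] makes [rev x] a rotation of [x]; the rotation point cuts [x] into two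
    palindromes. *)
Lemma pal_conj_rev (A : finType) (x g z z' : seq A) :
  x ++ z = z ++ g -> rev x ++ z' = z' ++ g -> pal x <= 2.
Proof.
move=> h1 h2; have [m /rot_rev_split[p q]] := conj_common_rot h1 h2.
rewrite -(cat_take_drop m x); apply: leq_trans (pal_cat _ _) _.
by apply: (@leq_add _ _ 1 1); apply: pal_palindrome; apply/eqP.
Qed.

(** * Morphisms, mirror images and marked conjugates *)

Section Morphisms.
Variable A : finType.
Implicit Types (phi psi : seq A -> seq A) (w x y z : seq A).

Lemma morphism_nil phi : word_morphism phi -> phi [::] = [::].
Proof.
move=> h; apply/nilP; rewrite /nilp; move: (congr1 size (h [::] [::])).
by rewrite /= size_cat; lia.
Qed.

Lemma morphism_cons phi c w : word_morphism phi ->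
  phi (c :: w) = phi [:: c] ++ phi w.
Proof. by move=> h; rewrite -h. Qed.

Lemma morphism_comp phi psi :
  word_morphism phi -> word_morphism psi -> word_morphism (phi \o psi).
Proof. by move=> h h' x y /=; rewrite h' h. Qed.

Lemma morphism_iter phi k : word_morphism phi -> word_morphism (iter k phi).
Proof. by move=> h; elim: k => // k IH x y; rewrite /= IH h. Qed.

Definition letter_morphism (g : A -> seq A) w := flatten (map g w).

Lemma letter_morphismP g : word_morphism (letter_morphism g).
Proof. by move=> x y; rewrite /letter_morphism map_cat flatten_cat. Qed.

Definition mirror phi w := rev (phi (rev w)).

Lemma mirror_morphism phi : word_morphism phi -> word_morphism (mirror phi).
Proof. by move=> h x y; rewrite /mirror rev_cat h rev_cat. Qed.

Lemma iter_mirror phi k w : iter k (mirror phi) w = mirror (iter k phi) w.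
Proof.
by elim: k => [|k IH]; rewrite /mirror /= ?revK // IH /mirror revK.
Qed.

Lemma morphism_letter_bound phi : exists M, forall c, size (phi [:: c]) <= M.
Proof.
exists (\max_(c : A) size (phi [:: c])) => c.
exact: (leq_bigmax (F := fun c => size (phi [:: c]))).
Qed.

Lemma morphism_size_ge phi k w : word_morphism phi ->
  (forall c, k <= size (phi [:: c])) -> k * size w <= size (phi w).
Proof.
move=> h hk; elim: w => [|c w IH]; first by rewrite muln0.
by rewrite (morphism_cons c w h) /= size_cat mulnS leq_add.
Qed.

Lemma iter_size_ge phi j c : word_morphism phi ->
  (forall c, 2 <= size (phi [:: c])) -> 2 ^ j <= size (iter j phi [:: c]).
Proof.
move=> h h2; elim: j => //= j IH; rewrite expnS.
by apply: leq_trans (morphism_size_ge _ h h2); rewrite leq_mul2l IH.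
Qed.

Lemma commuting_image phi a b w : word_morphism phi ->
  (forall c : A, c = a \/ c = b) ->
  phi [:: a] ++ phi [:: b] = phi [:: b] ++ phi [:: a] ->
  phi [:: a] ++ phi w = phi w ++ phi [:: a].
Proof.
move=> h hab com; elim: w => [|c w IH]; first by rewrite (morphism_nil h) ?cats0.
rewrite (morphism_cons c w h) -catA -IH !catA; congr (_ ++ _).
by case: (hab c) => ->.
Qed.

(* A longest [z] works: a common first letter of the two images of [g] could be
   appended to [z], and a [z] of length [|phi a| + |phi b|] would begin with both
   [phi (ab)] and [phi (ba)]. *)
Lemma marked_conjugate phi a b : word_morphism phi ->
  (forall c : A, c = a \/ c = b) -> (forall c, 0 < size (phi [:: c])) ->
  phi [:: a] ++ phi [:: b] <> phi [:: b] ++ phi [:: a] ->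
  exists z g (p : A -> A), [/\ word_morphism g,
    forall w, phi w ++ z = z ++ g w, p a != p b &
    forall c, exists t, g [:: c] = p c :: t].
Proof.
move=> h hab pos ncom.
pose P n := `[< exists z (g : A -> seq A), size z = n /\
                  forall c, phi [:: c] ++ z = z ++ g c >].
have P0 : exists n, P n.
  exists 0; apply/asboolP; exists [::], (fun c => phi [:: c]).
  by split => // c; rewrite cats0.
have bnd n : P n -> n <= size (phi [:: a]) + size (phi [:: b]).
  move=> /asboolP[z [g [<- E]]]; rewrite leqNgt; apply/negP => lt; apply: ncom.
  have tk c n' : n' <= size z -> take n' (phi [:: c] ++ z) = take n' z.
    move=> le; rewrite E take_cat ltn_neqAle le andbT.
    by case: eqP => //= ->; rewrite subnn take0 cats0 take_size.
  have pre c c' : size (phi [:: c]) + size (phi [:: c']) <= size z ->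
      take (size (phi [:: c]) + size (phi [:: c'])) z = phi [:: c] ++ phi [:: c'].
    move=> le; rewrite -(tk c) // take_cat ltnNge leq_addr /= addKn.
    by rewrite -(tk c') ?take_size_cat //; apply: leq_trans le; apply: leq_addl.
  rewrite -pre; last by lia.
  by rewrite addnC pre //; lia.
case: (ex_maxnP P0 bnd) => n /asboolP[z [g [sz E]]] nmax.
have sg c : size (g c) = size (phi [:: c]).
  by move: (congr1 size (E c)); rewrite !size_cat addnC; lia.
exists z, (letter_morphism g), (fun c => head a (g c)); split.
- exact: letter_morphismP.
- elim=> [|c w IH]; first by rewrite (morphism_nil h) ?cats0.
  by rewrite (morphism_cons c w h) -catA IH catA E -catA.
- apply/eqP => eqh.
  have hd c : g c = head a (g a) :: behead (g c).
    have : 0 < size (g c) by rewrite sg.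
    by case: (hab c) => ->; [|rewrite eqh]; case: (g _).
  suff /nmax : P n.+1 by rewrite ltnn.
  apply/asboolP; exists (rcons z (head a (g a))).
  exists (fun c => rcons (behead (g c)) (head a (g a))).
  split; first by rewrite size_rcons sz.
  by move=> c; rewrite -!cats1 catA E {1}hd -!catA.
- move=> c; exists (behead (g c)); rewrite /letter_morphism /= cats0.
  by have : 0 < size (g c); [rewrite sg|case: (g c)].
Qed.

(* A permutation of a two-letter alphabet is an involution, hence the square of
   the marked conjugate fixes first letters. *)
Lemma square_marked_conjugate phi a b : word_morphism phi ->
  (forall c : A, c = a \/ c = b) -> (forall c, 0 < size (phi [:: c])) ->
  phi [:: a] ++ phi [:: b] <> phi [:: b] ++ phi [:: a] ->
  exists z g, [/\ word_morphism g,
    forall w, phi (phi w) ++ z = z ++ g w &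
    forall c, exists t, g [:: c] = c :: t].
Proof.
move=> h hab pos ncom.
have [z [g [p [hg E pab hd]]]] := marked_conjugate h hab pos ncom.
exists (phi z ++ z), (g \o g); split.
- exact: morphism_comp.
- by move=> w; rewrite catA -h (E w) h -catA E -catA.
- have pp c : p (p c) = c.
    have [ea|ea] := hab (p a); have [eb|eb] := hab (p b);
      case: (hab c) => ->; move: pab; rewrite ?ea ?eb ?ea ?eb ?eqxx //.
  move=> c /=; have [t ->] := hd c; have [t' E'] := hd (p c).
  by rewrite (morphism_cons _ _ hg) E' pp; eexists.
Qed.

End Morphisms.

(** * Block structure, recurrence and periodicity of a fixed point *)

Section InfiniteWord.
Variables (A : finType) (u : nat -> A).
Implicit Types (phi psi F : seq A -> seq A).

Lemma size_subword q n : size (subword u q n) = n.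
Proof. exact: size_mkseq. Qed.

Lemma nth_subword x0 q n i : i < n -> nth x0 (subword u q n) i = u (q + i).
Proof. exact: nth_mkseq. Qed.

Lemma subword1 q : subword u q 1 = [:: u q].
Proof. by rewrite /subword /mkseq /= addn0. Qed.

Lemma subword_cat q m n :
  subword u q (m + n) = subword u q m ++ subword u (q + m) n.
Proof.
rewrite /subword /mkseq iotaD map_cat add0n; congr (_ ++ _).
rewrite -[in iota m n](addn0 m) iotaDl -map_comp.
by apply: eq_map => i /=; rewrite addnA.
Qed.

Lemma eq_subwordE q r n i : subword u q n = subword u r n -> i < n ->
  u (q + i) = u (r + i).
Proof. by move=> E lt; rewrite -!(nth_subword (u 0) _ lt) E. Qed.

Lemma subword_palindromeE i n t : palindrome (subword u i n) -> t < n ->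
  u (i + t) = u (i + (n - t.+1)).
Proof.
move=> /eqP E lt; rewrite -(nth_subword (u 0) _ lt) -E nth_rev size_subword //.
by rewrite nth_subword //; lia.
Qed.

Lemma subword_palindrome i n :
  (forall t, t < n -> u (i + t) = u (i + (n - t.+1))) ->
  palindrome (subword u i n).
Proof.
move=> h; apply/eqP; apply: (@eq_from_nth _ (u 0)) => [|t]; rewrite size_rev //.
rewrite size_subword => lt; rewrite nth_rev size_subword //.
by rewrite !nth_subword ?(h t) //; lia.
Qed.

Lemma rev_subword i n q k : palindrome (subword u i n) -> i <= q ->
  q + k <= i + n -> rev (subword u q k) = subword u (i + (i + n) - (q + k)) k.
Proof.
move=> hp iq qk; apply: (@eq_from_nth _ (u 0)); rewrite size_rev !size_subword // => t lt.
rewrite nth_rev size_subword // !nth_subword //; last by lia.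
have := @subword_palindromeE i n (q + (k - t.+1) - i) hp.
rewrite subnKC; last by lia.
move=> ->; last by lia.
by congr u; lia.
Qed.

(** A finite form of [phi(u) = u] that passes to the iterates of [phi]. *)
Definition preserves_prefixes phi := forall n,
  phi (subword u 0 n) = subword u 0 (size (phi (subword u 0 n))).

Lemma preserves_prefixes_iter phi k :
  preserves_prefixes phi -> preserves_prefixes (iter k phi).
Proof.
move=> h; elim: k => [n|k IH n]; first by rewrite /= size_subword.
by rewrite /= IH -h.
Qed.

Lemma bounded_gaps (f : nat -> nat) M : f 0 <= M ->
  (forall m, f m < f m.+1 <= f m + M) -> forall x, exists m, x <= f m <= x + M.
Proof.
move=> f0 fS; elim=> [|x [m /andP[h1 h2]]]; first by exists 0.
have [lt|le] := ltnP x (f m); first by exists m; lia.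
by exists m.+1; have := fS m; lia.
Qed.

(** When [psi] fixes [u], this is the position in [u] where the block [psi [:: u m]] starts. *)
Definition boundary psi m := size (psi (subword u 0 m)).

Section FixedPoint.
Variables (psi : seq A -> seq A) (M : nat).
Hypotheses (mor : word_morphism psi) (fixu : preserves_prefixes psi).
Hypotheses (pos : forall c, 0 < size (psi [:: c]))
  (bnd : forall c, size (psi [:: c]) <= M).

Let beta := boundary psi.

Lemma boundary_add m k : beta (m + k) = beta m + size (psi (subword u m k)).
Proof. by rewrite /beta /boundary subword_cat mor size_cat add0n. Qed.

Lemma boundaryS m : beta m.+1 = beta m + size (psi [:: u m]).
Proof. by rewrite -addn1 boundary_add subword1. Qed.

Lemma boundary0 : beta 0 = 0.
Proof. by rewrite /beta /boundary /= (morphism_nil mor). Qed.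

Lemma boundary_le m n : (m <= n) = (beta m <= beta n).
Proof.
symmetry; apply: leq_mono; apply: homo_ltn; first exact: ltn_trans.
by move=> k; rewrite boundaryS -{1}(addn0 (beta k)) ltn_add2l.
Qed.

Lemma boundary_gaps x : exists m, x <= beta m <= x + M.
Proof.
apply: bounded_gaps; first by rewrite boundary0.
by move=> m; rewrite boundaryS leq_add2l bnd -{1}(addn0 (beta m)) ltn_add2l pos.
Qed.

Lemma image_subword m k :
  psi (subword u m k) = subword u (beta m) (size (psi (subword u m k))).
Proof.
have := fixu (m + k); rewrite -/(boundary psi _) -/beta boundary_add.
rewrite !subword_cat !add0n mor fixu => /eqP.
by rewrite eqseq_cat ?size_subword // => /andP[_ /eqP].
Qed.

Lemma image_subword_boundary m n : m <= n ->
  psi (subword u m (n - m)) = subword u (beta m) (beta n - beta m).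
Proof. by move=> le; rewrite image_subword -{2}(subnKC le) boundary_add addKn. Qed.

End FixedPoint.

Definition periodic_word := exists2 N, 0 < N & forall t, u (t + N) = u t.

(** [psi [:: a]] commutes with the images of all prefixes of [u], which are arbitrarily long
    prefixes of [u]; hence [u] is invariant under the shift by the length of [psi [:: a]]. *)
Lemma commuting_periodic psi a b : word_morphism psi -> preserves_prefixes psi ->
  (forall c, 0 < size (psi [:: c])) -> (forall c, c = a \/ c = b) ->
  psi [:: a] ++ psi [:: b] = psi [:: b] ++ psi [:: a] -> periodic_word.
Proof.
move=> mor fixu pos hab com; exists (size (psi [:: a])) => // t.
have [M bnd] := morphism_letter_bound psi.
have [m /andP[le _]] := boundary_gaps mor pos bnd (t + size (psi [:: a])).+1.
have := esym (commuting_image (subword u 0 m) mor hab com).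
move=> /(congr1 (fun s => nth (u 0) s (size (psi [:: a]) + t))).
rewrite /boundary in le.
rewrite [nth _ (psi [:: a] ++ _) _]nth_cat ltnNge leq_addr /= addKn nth_cat addnC le.
rewrite fixu !nth_subword //.
exact: leq_ltn_trans (leq_addr _ _) le.
Qed.

(** Uniform recurrence, for prefixes only: [L] is a window length that forces an occurrence of the
    prefix of length [t]. *)
Definition recurrent_prefixes := forall t, exists L, forall q, exists r,
  [/\ q <= r, r + t <= q + L & forall i, i < t -> u (r + i) = u i].

(** Every block of the power [t.+1] contains the image of [u 0] under the power [t], because [sigma]
    of any letter contains [u 0]. That image is a prefix of [u] of length at least [2 ^ t]. *)
Lemma primitive_recurrent sigma : word_morphism sigma ->
  preserves_prefixes sigma -> (forall c d, d \in sigma [:: c]) ->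
  (forall c, 2 <= size (sigma [:: c])) -> recurrent_prefixes.
Proof.
move=> mor fixu prim sz t.
pose theta := iter t sigma; pose Theta := iter t.+1 sigma.
have mt : word_morphism theta by exact: morphism_iter.
have mT : word_morphism Theta by exact: morphism_iter.
have fT : preserves_prefixes Theta by exact: preserves_prefixes_iter.
have posT c : 0 < size (Theta [:: c]).
  by apply: leq_trans (iter_size_ge _ _ mor sz); rewrite expn_gt0.
have [M bnd] := morphism_letter_bound Theta.
have ut : theta [:: u 0] = subword u 0 (size (theta [:: u 0])).
  have := preserves_prefixes_iter t fixu 1; by rewrite subword1.
have le : t <= size (theta [:: u 0]).
  by apply: leq_trans (iter_size_ge _ _ mor sz); rewrite ltnW // ltn_expl.
(* At most [M] letters precede the next block boundary, and the block there has at most [M] more. *)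
exists (M + M) => q; have [m /andP[m1 m2]] := boundary_gaps mT posT bnd q.
have E : Theta [:: u m] = subword u (boundary Theta m) (size (Theta [:: u m])).
  by have := image_subword mT fT m 1; rewrite subword1.
have [s1 [s2 Es]] : exists s1 s2, sigma [:: u m] = s1 ++ u 0 :: s2.
  by case/splitPr: (prim (u m) (u 0)) => s1 s2; exists s1, s2.
have E2 : Theta [:: u m] = theta s1 ++ theta [:: u 0] ++ theta s2.
  by rewrite /Theta iterSr Es -/theta mt (morphism_cons _ _ mt).
have sT : size (theta s1) + size (theta [:: u 0]) <= size (Theta [:: u m]).
  by rewrite E2 !size_cat; lia.
exists (boundary Theta m + size (theta s1)); split; first by lia.
  by have := bnd (u m); lia.
move=> i it; have it' : i < size (theta [:: u 0]) by lia.
have lt : size (theta s1) + i < size (Theta [:: u m]) by lia.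
rewrite -addnA -(nth_subword (u 0) _ lt) -E E2 nth_cat ltnNge leq_addr /= addKn.
by rewrite nth_cat it' ut nth_subword.
Qed.

(** The factorial of [T] is a multiple of every admissible [p]. A window of period [p] that contains
    the prefix of length [t + T! + 1] shows that this shift preserves the letter at [t]. *)
Lemma recurrent_periodic T : recurrent_prefixes ->
  (forall n, exists q p, 0 < p <= T /\ forall i, i < n -> u (q + i) = u (q + p + i)) ->
  periodic_word.
Proof.
move=> rec per; exists T`!; first exact: fact_gt0.
move=> t; have [L hL] := rec (t + T`!).+1.
have [q [p [pT hp]]] := per L; have [r [r1 r2 hr]] := hL q.
have step k : r + t + k * p < q + L -> u (r + t + k * p) = u (r + t).
  elim: k => [|k IH] lt; first by rewrite mul0n addn0.
  rewrite -IH; last by lia.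
  have := hp (r + t + k * p - q).
  rewrite subnKC; last by lia.
  by rewrite mulSn => ->; [congr u; lia|lia].
rewrite -hr; last by lia.
rewrite -[RHS]hr; last by lia.
have /dvdnP[k kE] : p %| T`! by apply: dvdn_fact; lia.
by rewrite -(step k) -?kE ?addnA //; lia.
Qed.

End InfiniteWord.

(** * Two morphisms parsing the same stretch of [u] in parallel *)

Section Parsing.
Variables (A : finType) (u : nat -> A).
Implicit Types F : seq A -> seq A.

(** The position [q] is a block boundary, while the last block may be cut off at [e]. *)
Definition parses F q e := exists v, prefix (subword u q (e - q)) (F v).

Definition keeps_first_letter F := forall c, exists t, F [:: c] = c :: t.

Lemma keeps_first_letter_size F c : keeps_first_letter F -> 0 < size (F [:: c]).
Proof. by move=> h; have [t ->] := h c. Qed.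

(** As [F c] starts with [c], the letter at a boundary determines the block to be read. *)
Lemma parses_step F q e : word_morphism F -> keeps_first_letter F ->
  parses F q e -> q + size (F [:: u q]) <= e ->
  subword u q (size (F [:: u q])) = F [:: u q] /\
  parses F (q + size (F [:: u q])) e.
Proof.
move=> mor first [v] /prefixP[s]; set l := size _ => E le.
have l0 : 0 < l by exact: keeps_first_letter_size.
have {}E : F v = subword u q l ++ subword u (q + l) (e - (q + l)) ++ s.
  by rewrite E catA -subword_cat; congr (subword _ _ _ ++ _); lia.
case: v E => [|c v]; rewrite ?(morphism_nil mor).
  by move=> /(congr1 size); rewrite !size_cat size_subword /=; lia.
rewrite (morphism_cons c v mor).
have [t Ec] := first c => E.
have cq : c = u q.
  move: (congr1 (nth (u 0) ^~ 0) E); rewrite Ec /= nth_cat size_subword l0.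
  by rewrite nth_subword // addn0.
move: E; rewrite cq => /eqP; rewrite eqseq_cat ?size_subword //.
move=> /andP[/eqP -> /eqP Ev]; split=> //.
by exists v; apply/prefixP; exists s.
Qed.

(** Turns a stretch of [u] conjugate to [y] into a stretch of [y] itself, by cancelling [z] in
    front. *)
Lemma conj_prefix q k e (z y : seq A) : subword u q k ++ z = z ++ y ->
  e <= q + k -> prefix (subword u (q + size z) (e - (q + size z))) y.
Proof.
move=> E le; have [le2|lt] := leqP (q + size z) e; last first.
  by rewrite (_ : e - _ = 0) ?prefix0s //; lia.
have kE : k = size z + (e - (q + size z) + (q + k - e)) by lia.
move: E; rewrite {1}kE !subword_cat -!catA => /eqP.
rewrite eqseq_cat ?size_subword // => /andP[_ /eqP <-].
exact: prefix_prefix.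
Qed.

Variable c : A.
Hypothesis binary : forall x y : A, x <> c -> y <> c -> x = y.

Variable M : nat.

Definition conflicting F1 F2 :=
  [/\ word_morphism F1 /\ keeps_first_letter F1,
      word_morphism F2 /\ keeps_first_letter F2,
      forall d, size (F1 [:: d]) = size (F2 [:: d]),
      forall d, size (F1 [:: d]) <= M & F1 [:: c] <> F2 [:: c]].

Lemma conflicting_sym F1 F2 : conflicting F1 F2 -> conflicting F2 F1.
Proof. by case=> h1 h2 h3 h4 h5; split=> [||d|d|/esym] //; rewrite -h3. Qed.

(** At a common boundary followed by [c], both blocks of [c] would be read from the same letters and
    have equal length, hence coincide. *)
Lemma conflicting_letter F1 F2 q e : conflicting F1 F2 -> parses F1 q e ->
  parses F2 q e -> q + M <= e -> u q <> c.
Proof.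
case=> -[m1 f1] [m2 f2] sz bnd ne p1 p2 le uq.
have le1 : q + size (F1 [:: u q]) <= e by have := bnd (u q); lia.
have [E1 _] := parses_step m1 f1 p1 le1; rewrite sz in le1.
have [E2 _] := parses_step m2 f2 p2 le1.
by apply: ne; rewrite -uq -E1 -E2 sz.
Qed.

(* At a common boundary only one letter is possible, elsewhere the pending part
   [u[q, q + d)] of the block of [F2] starts with the next letter to be parsed. *)
Lemma parse_deterministic n F1 F2 q r d e : conflicting F1 F2 ->
  parses F1 q e -> parses F2 (q + d) e -> parses F1 r e -> parses F2 (r + d) e ->
  (forall i, i < d -> u (q + i) = u (r + i)) ->
  q + n + M <= e -> r + n + M <= e ->
  forall i, i < n -> u (q + i) = u (r + i).
Proof.
have [N] := ubnP n; elim: N n F1 F2 q r d => // N IH n F1 F2 q r d nN con.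
move=> p1 p2 p3 p4 agree le1 le2 i lt.
have [[m1 f1] [m2 f2] sz bnd _] := con.
have uqr : u q = u r.
  case: d p2 p4 agree => [|d] p2 p4 agree; last by have := agree 0; rewrite !addn0; apply.
  rewrite !addn0 in p2 p4.
  by apply: binary; [apply: conflicting_letter con p1 p2 _|
                     apply: conflicting_letter con p3 p4 _]; lia.
pose l := size (F1 [:: u q]).
have l0 : 0 < l by exact: keeps_first_letter_size.
have lM : l <= M by exact: bnd.
have [E1 p1'] : subword u q l = F1 [:: u q] /\ parses F1 (q + l) e.
  by apply: parses_step => //; rewrite -/l; lia.
have [E2 p3'] : subword u r l = F1 [:: u q] /\ parses F1 (r + l) e.
  by rewrite /l uqr; apply: parses_step => //; rewrite -uqr -/l; lia.
have agreel j : j < l -> u (q + j) = u (r + j).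
  by apply: eq_subwordE; rewrite E1 E2.
have [il|li] := ltnP i l; first exact: agreel.
have [dl|ld|dl] := ltngtP l d.
(* [F1] reads a block of length [l]. It remains behind [F2], or overtakes it and the roles swap, or
   both reach a common boundary. *)
- have := IH (n - l) F1 F2 (q + l) (r + l) (d - l) _ con p1' _ p3' _ _ _ _ (i - l).
  rewrite -!addnA !subnKC //; try lia.
  apply=> //; try lia.
  by move=> j jd; rewrite -!addnA; apply: agree; lia.
- have id : d <= i by lia.
  case: (posnP d) => [d0|d0].
    have p2' : parses F2 (q + l) e.
      rewrite /l sz; apply: (parses_step m2 f2 _ _).2.
        by move: p2; rewrite d0 addn0.
      by rewrite -sz -/l; lia.
    have p4' : parses F2 (r + l) e.
      rewrite /l uqr sz; apply: (parses_step m2 f2 _ _).2.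
        by move: p4; rewrite d0 addn0.
      by rewrite -sz -uqr -/l; lia.
    have := IH (n - l) F1 F2 (q + l) (r + l) 0 _ con p1' _ p3' _ _ _ _ (i - l).
    rewrite !addn0 -!addnA !subnKC //; try lia.
    by apply=> //; lia.
  have := IH (n - d) F2 F1 (q + d) (r + d) (l - d) _ (conflicting_sym con)
    p2 _ p4 _ _ _ _ (i - d).
  rewrite -!addnA !subnKC //; try lia.
  apply=> //; try lia.
  by move=> j jd; rewrite -!addnA; apply: agreel; lia.
- rewrite -dl in p2 p4.
  have := IH (n - l) F1 F2 (q + l) (r + l) 0 _ con p1' _ p3' _ _ _ _ (i - l).
  rewrite !addn0 -!addnA !subnKC //; try lia.
  by apply=> //; lia.
Qed.

Variables (G H : seq A -> seq A).
Hypothesis con : conflicting G H.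

Let side (b : bool) := if b then G else H.

Let con_side b : conflicting (side b) (side (~~ b)).
Proof. by case: b => //=; apply: conflicting_sym. Qed.

(** The flag [b] tells which morphism is behind, [q] is its boundary and [d] is the lead of the
    other one. *)
Definition parse_state e b q d :=
  [/\ d <= M, parses (side b) q e & parses (side (~~ b)) (q + d) e].

Lemma parse_state_step e b q d : parse_state e b q d -> q + M + M <= e ->
  exists b' q' d', parse_state e b' q' d' /\ q < q' <= q + M.
Proof.
case=> dM p1 p2 le.
have [[m1 f1] [m2 f2] sz bnd _] := con_side b.
pose l := size (side b [:: u q]).
have l0 : 0 < l by exact: keeps_first_letter_size.
have lM : l <= M by exact: bnd.
have [_ p1'] : subword u q l = side b [:: u q] /\ parses (side b) (q + l) e.
  by apply: parses_step => //; rewrite -/l; lia.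
have [ld|dl] := leqP l d.
  exists b, (q + l), (d - l); split; last by lia.
  by split=> //; [lia|rewrite -addnA subnKC].
case: (posnP d) => [d0|d0]; last first.
  exists (~~ b), (q + d), (l - d); split; last by lia.
  by split=> //; rewrite ?negbK -?addnA ?subnKC //; lia.
exists b, (q + l), 0; split; last by lia.
split=> //; rewrite addn0 /l sz; apply: (parses_step m2 f2 _ _).2.
  by move: p2; rewrite d0 addn0.
by rewrite -sz -/l; lia.
Qed.

Lemma parse_state_gaps e b0 q0 d0 : parse_state e b0 q0 d0 ->
  forall x, q0 + x + M + M <= e ->
  exists b q d, parse_state e b q d /\ q0 + x <= q <= q0 + x + M.
Proof.
move=> st0; elim=> [|x IH] le; first by exists b0, q0, d0; split=> //; lia.
have [|b [q [d [st hq]]]] := IH; first by lia.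
have [lt|ge] := ltnP (q0 + x) q; first by exists b, q, d; split=> //; lia.
have [|b' [q' [d' [st' hq']]]] := parse_state_step st; first by lia.
by exists b', q', d'; split=> //; lia.
Qed.

(** Pigeonhole: two states at bounded distance agree in the flag, the lead and the next [M] letters,
    which cover the pending block. By determinism the word then continues identically from both. *)
Lemma conflicting_long_period :
  (forall n, exists e b q d, parse_state e b q d /\ q + n <= e) ->
  exists T, forall n, exists q p,
    0 < p <= T /\ forall i, i < n -> u (q + i) = u (q + p + i).
Proof.
move=> long.
pose K := (bool * 'I_M.+1 * M.-tuple A)%type.
(* Among [S + 1] states two share a key, and [W] bounds the distance between any two of them. *)
pose S := #|{: K}|; pose W := S * M.+1 + M.
exists W => n.
have [e [b0 [q0 [d0 [st0 he]]]]] := long (W + n + M + M).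
(* States are located up to an error [M], so the spacing [M.+1] makes their positions strictly
   increasing. *)
have ex (t : 'I_S.+1) : exists s : bool * nat * nat,
    parse_state e s.1.1 s.1.2 s.2 /\ q0 + t * M.+1 <= s.1.2 <= q0 + t * M.+1 + M.
  have tS : t * M.+1 <= S * M.+1 by rewrite leq_mul2r -ltnS ltn_ord orbT.
  have [|b [q [d hs]]] := parse_state_gaps st0 (x := t * M.+1).
    by rewrite /W in he; lia.
  by exists (b, q, d).
have {ex}[f hf] := fin_all_exists ex.
pose key (t : 'I_S.+1) : K :=
  ((f t).1.1, inord (f t).2, [tuple u ((f t).1.2 + i) | i < M]).
have : ~~ injectiveb key.
  apply/negP => /injectiveP /leq_card; rewrite card_ord -/S; lia.
case/injectivePn => t1 [t2] ne12 keyE.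
wlog lt12 : t1 t2 ne12 keyE / t1 < t2.
  move=> wl; case: (ltngtP t1 t2) => [||/val_inj E]; first exact: wl.
    by apply: wl; rewrite 1?eq_sym.
  by rewrite E eqxx in ne12.
have [[d1M p1 p1'] /andP[lo1 hi1]] := hf t1.
have [[d2M p2 p2'] /andP[lo2 hi2]] := hf t2.
have eb : (f t1).1.1 = (f t2).1.1 by have := congr1 (fun k => k.1.1) keyE.
have ed : (f t1).2 = (f t2).2.
  by have := congr1 (fun k => val k.1.2) keyE; rewrite /= !inordK ?ltnS.
have eu i : i < M -> u ((f t1).1.2 + i) = u ((f t2).1.2 + i).
  move=> iM.
  have := congr1 (fun k => tnth k.2 (Ordinal iM)) keyE.
  by rewrite /= !tnth_mktuple.
set q := (f t1).1.2 in p1 p1' lo1 hi1 eu *.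
set r := (f t2).1.2 in p2 p2' lo2 hi2 eu *.
rewrite -eb -ed in p2 p2'.
have t2S : t2 * M.+1 <= S * M.+1 by rewrite leq_mul2r -ltnS ltn_ord orbT.
have t12 : t1 * M.+1 + M.+1 <= t2 * M.+1 by rewrite addnC -mulSn leq_mul2r lt12 orbT.
have agree i : i < (f t1).2 -> u (q + i) = u (r + i).
  by move=> id; apply: eu; apply: leq_trans d1M.
exists q, (r - q); split; first by rewrite /W; lia.
rewrite subnKC; last by lia.
apply: (parse_deterministic (con_side _) p1 p1' p2 p2' agree); rewrite /W in he; lia.
Qed.

End Parsing.

(** * Long palindromes force images of letters to be products of two palindromes *)

Section Palindromic.
Variables (A : finType) (u : nat -> A).

Definition long_palindromes := forall n, exists i m,
  n <= m /\ palindrome (subword u i m).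

Lemma square_image_pal tau a b c : word_morphism tau ->
  preserves_prefixes u tau -> (forall d, 0 < size (tau [:: d])) ->
  (forall d : A, d = a \/ d = b) -> recurrent_prefixes u -> long_palindromes ->
  ~ periodic_word u -> pal (tau (tau [:: c])) <= 2.
Proof.
move=> mor fixu pos hab rec longp nper.
have ncom : tau [:: a] ++ tau [:: b] <> tau [:: b] ++ tau [:: a].
  by move=> com; apply: nper; apply: commuting_periodic com.
pose psi := tau \o tau.
have mpsi : word_morphism psi by exact: morphism_comp.
have fpsi : preserves_prefixes u psi by exact: (preserves_prefixes_iter 2 fixu).
have pospsi d : 0 < size (psi [:: d]).
  have := morphism_size_ge (tau [:: d]) mor pos; rewrite mul1n.
  exact: leq_trans (pos d).
have [M0 bnd] := morphism_letter_bound psi.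
have [z [G [mG EG fG]]] := square_marked_conjugate mor hab pos ncom.
have [z' [H [mH EH fH]]] : exists z' H, [/\ word_morphism H,
    forall w, rev (psi (rev w)) ++ z' = z' ++ H w & keeps_first_letter H].
  have posm d : 0 < size (mirror tau [:: d]) by rewrite size_rev; apply: pos.
  have ncomm : mirror tau [:: a] ++ mirror tau [:: b] <>
               mirror tau [:: b] ++ mirror tau [:: a].
    move=> /(congr1 rev); rewrite /mirror !rev_cat !revK => E.
    exact: ncom.
  have [z' [H [mH EH fH]]] :=
    square_marked_conjugate (mirror_morphism mor) hab posm ncomm.
  exists z', H; split=> // w; rewrite -EH.
  by have := iter_mirror tau 2 w => /= ->.
have [GH|GH] := pselect (G [:: c] = H [:: c]).
  apply: (@pal_conj_rev _ _ (G [:: c]) z z'); first exact: EG.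
  by rewrite GH -EH.
(* The lead of [G] in the initial state is at most a block length [M0] plus the shift [size z] due
   to conjugation. *)
case: nper; pose M := M0 + size z.
have binary x y : x <> c -> y <> c -> x = y.
  by case: (hab x) (hab y) (hab c) => [] -> [] -> [] ->.
have sG d : size (G [:: d]) = size (psi [:: d]).
  have := congr1 size (EG [:: d]); rewrite !size_cat addnC => /eqP.
  by rewrite eqn_add2l eq_sym => /eqP.
have sH d : size (H [:: d]) = size (psi [:: d]).
  have := congr1 size (EH [:: d]); rewrite !size_cat size_rev addnC => /eqP.
  by rewrite eqn_add2l eq_sym => /eqP.
have con : conflicting c M G H.
  split=> // d; first by rewrite sG sH.
  by rewrite sG; apply: leq_trans (bnd d) _; rewrite leq_addr.
suff long n : exists e b q d, parse_state u M G H e b q d /\ q + n <= e.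
  by have [T /(recurrent_periodic rec)] := conflicting_long_period binary con long.
have [i [m [nm hp]]] := longp (n + M0 + M0 + size z').+1.
have [m1 /andP[lo1 hi1]] := boundary_gaps u mpsi pospsi bnd i.
have [m2 /andP[lo2 hi2]] := boundary_gaps u mpsi pospsi bnd (i + m - M0).
set b1 := boundary u psi m1 in lo1 hi1; set b2 := boundary u psi m2 in lo2 hi2.
have m12 : m1 <= m2 by rewrite (boundary_le u mpsi pospsi) -/b1 -/b2; lia.
(* Reflection in the palindrome carries the stretch from [b1] to [b2], made of whole [psi] blocks,
   to a stretch starting at [k] made of reversed blocks. Conjugation then yields a parse by [H]. *)
pose k := i + (i + m) - b2.
have pH : parses u H (k + size z') (i + (i + m) - b1).
  exists (rev (subword u m1 (m2 - m1))).
  apply: (@conj_prefix _ u k (b2 - b1)); last by rewrite /k; lia.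
  rewrite -EH revK (image_subword_boundary mpsi fpsi m12) -/b1 -/b2.
  congr (_ ++ _); rewrite (rev_subword hp); try lia.
  by rewrite /k; congr subword; lia.
(* The parse by [G] comes from the blocks of [u] itself; it starts from the first boundary found
   after the start of the parse by [H]. *)
have [m3 /andP[lo3 hi3]] := boundary_gaps u mpsi pospsi bnd (k + size z').
set b3 := boundary u psi m3 in lo3 hi3.
have pG e : parses u G (b3 + size z) e.
  have [m4 /andP[lo4 _]] := boundary_gaps u mpsi pospsi bnd (e + b3).
  set b4 := boundary u psi m4 in lo4.
  have m34 : m3 <= m4 by rewrite (boundary_le u mpsi pospsi) -/b3 -/b4; lia.
  exists (subword u m3 (m4 - m3)).
  apply: (@conj_prefix _ u b3 (b4 - b3)); last by lia.
  by rewrite -EG -(image_subword_boundary mpsi fpsi m34).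
exists (i + (i + m) - b1), false, (k + size z'), (b3 + size z - (k + size z')).
split; last by rewrite /k; lia.
split; [by rewrite /M; lia | exact: pH | rewrite subnKC; [exact: pG | lia]].
Qed.

End Palindromic.

(** * Logarithmic bound for factors of iterated images *)

Lemma cat_eq_cat (T : Type) (x y p r : seq T) : x ++ y = p ++ r ->
  (exists t, x = p ++ t /\ r = t ++ y) \/ (exists t, p = x ++ t /\ y = t ++ r).
Proof.
elim: x p => [|c x IH] [|d p] /=.
- by move=> ->; left; exists [::].
- by move=> ->; right; exists (d :: p).
- by move=> <-; left; exists (c :: x).
- by case=> <- /IH[] [t [-> ->]]; [left | right]; exists t.
Qed.

Lemma prefix_catP (T : eqType) (w x y : seq T) : prefix w (x ++ y) ->
  prefix w x \/ (exists2 t, w = x ++ t & prefix t y).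
Proof.
case/prefixP => s /cat_eq_cat[] [t [E1 E2]]; [left | right].
  by rewrite E1 prefix_prefix.
by exists t; rewrite // E2 prefix_prefix.
Qed.

Lemma infix_catP (T : eqType) (w x y : seq T) : infix w (x ++ y) ->
  [\/ infix w x, infix w y |
      exists s p, [/\ w = s ++ p, suffix s x & prefix p y]].
Proof.
case/infixP => [p0 [s0]] /cat_eq_cat[] [t [xE]]; last first.
  by move=> ->; apply: Or32; apply/infixP; exists t, s0.
move=> /esym /cat_eq_cat[] [t' [E1 E2]]; last first.
  apply: Or33; exists t, t'; rewrite E1 xE E2; split=> //.
    exact: suffix_suffix.
  exact: prefix_prefix.
by apply: Or31; apply/infixP; exists p0, t'; rewrite xE E1.
Qed.

Section LogarithmicBound.
Variable A : finType.

(** Each complete block costs at most 2. The incomplete one is a prefix of a lower iterate applied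
    to at most [M] letters, which costs [2 * M] more per level. *)
Lemma prefix_iter_pal (Phi : seq A -> seq A) M j v w : word_morphism Phi ->
  (forall i c, pal (iter i Phi [:: c]) <= 2) ->
  (forall c, size (Phi [:: c]) <= M) ->
  prefix w (iter j Phi v) -> pal w <= 2 * size v + 2 * M * j.
Proof.
move=> mor hp bnd; elim: j v w => [|j IHj] v w.
  by move=> /size_prefix /=; have := pal_size w; lia.
elim: v w => [|c v IHv] w.
  rewrite (morphism_nil (morphism_iter _ mor)) prefixs0 => /eqP ->.
  exact: leq_trans (pal_size _) _.
rewrite (morphism_cons c v (morphism_iter _ mor)) => /prefix_catP[|[t ->] /IHv h].
  by rewrite iterSr => /IHj; have := bnd c; rewrite mulnS; lia.
by have := pal_cat (iter j.+1 Phi [:: c]) t; have := hp j.+1 c; rewrite /=; lia.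
Qed.

Lemma suffix_iter_pal (Phi : seq A -> seq A) M j v w : word_morphism Phi ->
  (forall i c, pal (iter i Phi [:: c]) <= 2) ->
  (forall c, size (Phi [:: c]) <= M) ->
  suffix w (iter j Phi v) -> pal w <= 2 * size v + 2 * M * j.
Proof.
move=> mor hp bnd; rewrite -prefix_rev -pal_rev -(size_rev v) => h.
apply: (@prefix_iter_pal (mirror Phi)).
- exact: mirror_morphism.
- by move=> i c; rewrite iter_mirror pal_rev; apply: hp.
- by move=> c; rewrite size_rev; apply: bnd.
- by rewrite iter_mirror /mirror revK.
Qed.

(** Descend while the infix lies in one block; once it straddles a cut, it is a suffix followed by a
    prefix, which doubles the cost per level. *)
Lemma infix_iter_pal (Phi : seq A -> seq A) M j v w : word_morphism Phi ->
  (forall i c, pal (iter i Phi [:: c]) <= 2) ->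
  (forall c, size (Phi [:: c]) <= M) ->
  infix w (iter j Phi v) -> pal w <= 2 * size v + 4 * M * j.
Proof.
move=> mor hp bnd; elim: j v w => [|j IHj] v w.
  by move=> /size_infix /=; have := pal_size w; lia.
elim: v w => [|c v IHv] w.
  rewrite (morphism_nil (morphism_iter _ mor)) infixs0 => /eqP ->.
  exact: leq_trans (pal_size _) _.
rewrite (morphism_cons c v (morphism_iter _ mor)).
move=> /infix_catP[|/IHv h|[s [p [-> hs hpr]]]].
- by rewrite iterSr => /IHj; have := bnd c; rewrite mulnS; lia.
- by move: h; rewrite /=; lia.
- rewrite iterSr in hs; have := suffix_iter_pal mor hp bnd hs.
  have := prefix_iter_pal mor hp bnd hpr.
  by have := pal_cat s p; have := bnd c; rewrite /= !mulnS; lia.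
Qed.

End LogarithmicBound.

(** * Bounds on the palindromic length of factors of [u] *)

Section PalLengthOfFactors.
Variables (A : finType) (u : nat -> A).

Lemma PL_le n B : (forall i, pal (subword u i n) <= B) -> PL u n <= B.
Proof.
move=> h; apply/bigmax_leqP => w /asboolP[i].
by rewrite size_tuple => ->.
Qed.

Lemma PL_ge i n : pal (subword u i n) <= PL u n.
Proof.
have sz : size (subword u i n) == n by rewrite size_subword.
apply: (leq_bigmax_cond (Tuple sz)); apply/asboolP.
by exists i; rewrite size_tuple.
Qed.

(** Blocks of the power [J] have length at least [2 ^ J], so a factor of length [n] fits in the
    image of two consecutive letters. *)
Lemma factor_log_pal Phi M J i n : word_morphism Phi ->
  preserves_prefixes u Phi -> (forall c, 2 <= size (Phi [:: c])) ->
  (forall j c, pal (iter j Phi [:: c]) <= 2) ->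
  (forall c, size (Phi [:: c]) <= M) ->
  n <= 2 ^ J -> pal (subword u i n) <= 4 + 4 * M * J.
Proof.
move=> mor fixu two hp bnd nJ; pose psi := iter J Phi.
have mpsi : word_morphism psi by exact: morphism_iter.
have fpsi : preserves_prefixes u psi by exact: preserves_prefixes_iter.
have big c : 2 ^ J <= size (psi [:: c]) by exact: iter_size_ge.
have pos c : 0 < size (psi [:: c]) by apply: leq_trans (big c); rewrite expn_gt0.
have [m /andP[lo hi]] : exists m, boundary u psi m <= i < boundary u psi m.+1.
  elim: i => [|i [m /andP[lo hi]]].
    by exists 0; rewrite (boundaryS u mpsi) (boundary0 u mpsi) add0n pos.
  have [lt|ge] := ltnP i.+1 (boundary u psi m.+1); first by exists m; lia.
  exists m.+1; rewrite ge (boundaryS u mpsi m.+1); have := pos (u m.+1); lia.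
have E := image_subword mpsi fpsi m 2.
apply: (@infix_iter_pal _ _ M J (subword u m 2)) => //.
have := boundary_add u mpsi m 2; set S := size _ in E * => E2.
have iS : i + n <= boundary u psi m + S.
  rewrite -E2 addn2 (boundaryS u mpsi m.+1); have := big (u m.+1); lia.
rewrite -/psi E; set b := boundary u psi m in lo iS *.
have -> : S = (i - b) + (n + (b + S - (i + n))) by lia.
rewrite !subword_cat subnKC //.
by apply/infixP; eexists; eexists.
Qed.

(* In a periodic word a long palindrome makes the reflection through its centre
   a symmetry modulo the period, so every long factor is a palindrome followed by
   fewer letters than the period. *)
Lemma periodic_pal_bounded : periodic_word u -> long_palindromes u ->
  exists B, forall i n, pal (subword u i n) <= B.
Proof.
move=> [N N0 per] longp; have [i0 [m [Nm hp]]] := longp N.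
have perk t k : u (t + k * N) = u t.
  by elim: k => [|k IH]; rewrite ?mul0n ?addn0 // mulSn addnCA addnC per.
have perm t t' : t = t' %[mod N] -> u t = u t'.
  move=> E; rewrite (divn_eq t N) (divn_eq t' N) E.
  by rewrite addnC perk [in RHS]addnC perk.
have le_mul x : x <= x * N by rewrite leq_pmulr.
(* Mirror positions in the long palindrome add up to [s]. *)
pose s := i0 + (i0 + (m - 1)).
have sym r r' : r + r' = s %[mod N] -> u r = u r'.
  move=> E; pose t := (r + i0 * N - i0) %% N.
  have tN : t < N by rewrite ltn_mod.
  have Et : i0 + t = r %[mod N].
    rewrite /t modnDmr subnKC; last by have := le_mul i0; lia.
    by rewrite addnC modnMDl.
  rewrite -(perm _ _ Et) (subword_palindromeE hp); last by lia.
  apply: perm; apply/eqP; rewrite -(eqn_modDl (i0 + t)); apply/eqP.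
  rewrite -[RHS]modnDml Et modnDml E /s; congr (_ %% _); lia.
exists N.+1 => x n.
have [nN|Nn] := ltnP n N.
  by apply: leq_trans (pal_size _) _; rewrite size_subword; lia.
(* Dropping the last [d] letters makes the end positions of the factor add up to [s] modulo [N]; the
   term [s * N] keeps the subtraction from truncating. *)
pose d := (x + (x + (n - 1)) + s * N - s) %% N.
have dN : d < N by rewrite ltn_mod.
have Ed : d + s = x + (x + (n - 1)) %[mod N].
  rewrite /d modnDml subnK; last by have := le_mul s; lia.
  by rewrite addnC modnMDl.
rewrite -(subnK (leq_trans (ltnW dN) Nn)) subword_cat.
apply: leq_trans (pal_cat _ _) _; rewrite -add1n; apply: leq_add; last first.
  by apply: leq_trans (pal_size _) _; rewrite size_subword; lia.
apply: pal_palindrome; apply: subword_palindrome => t lt.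
apply: sym; apply/eqP; rewrite -(eqn_modDl d) Ed; apply/eqP; congr (_ %% _); lia.
Qed.

(** The pieces of a palindromic factorization of a factor are themselves factors of [u], so each has
    length at most [L]. *)
Lemma bounded_palindromes_pal L i n :
  (forall j m, palindrome (subword u j m) -> m <= L) ->
  n <= pal (subword u i n) * L.
Proof.
move=> hL; have [s [s1 s2 <-]] := palP (subword u i n).
elim: s i n s1 s2 => [|p s IH] i n /=.
  by move=> _ /(congr1 size); rewrite size_subword => <-.
move=> /andP[pp ps] E.
have sz : n = size p + size (flatten s) by rewrite -size_cat E size_subword.
move: E; rewrite sz subword_cat => /eqP.
rewrite eqseq_cat ?size_subword // => /andP[/eqP Ep /eqP Es].
rewrite mulSn; apply: leq_add; last exact: IH Es.
by rewrite Ep in pp; apply: hL pp.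
Qed.

End PalLengthOfFactors.

(** * The dichotomy with real constants *)

Import Order.TTheory GRing.Theory Num.Theory.
Local Open Scope ring_scope.

Theorem theorem10 (R : realType) (A : finType) (phi : seq A -> seq A)
    (u : nat -> A) (hA : #|A| = 2%N) (hphi : primitive_morphism phi)
    (hu : fixed_point phi u) :
  exists K : R, 0 < K /\
    ((forall n : nat, (2 <= n)%N -> (PL u n)%:R <= K * ln n%:R) \/
     (forall n : nat, (1 <= n)%N -> K * n%:R <= (PL u n)%:R)).
Proof.
have ln2 : 0 < ln (2%:R : R) by apply: ln_gt0; rewrite ltr1n.
have bounded_case B : (forall i n, pal (subword u i n) <= B)%N ->
    exists K : R, 0 < K /\
    ((forall n : nat, (2 <= n)%N -> (PL u n)%:R <= K * ln n%:R) \/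
     (forall n : nat, (1 <= n)%N -> K * n%:R <= (PL u n)%:R)).
  (* The successor keeps the constant positive, and [ln n] is at least [ln 2]. *)
  move=> hB; exists (B.+1%:R / ln 2%:R); split; first by rewrite divr_gt0.
  left=> n n2; apply: (@le_trans _ _ B.+1%:R).
    by rewrite ler_nat; apply: leq_trans (PL_le (fun i => hB i n)) _.
  rewrite mulrAC ler_pdivlMr // ler_pM2l // ler_ln ?ler_nat //.
    by rewrite posrE ltr0n.
  by rewrite posrE ltr0n; lia.
have [longp|nlong] := pselect (long_palindromes u); last first.
  have [L hL] : exists L, forall j m, palindrome (subword u j m) -> (m <= L)%N.
    apply: contrapT => no; apply: nlong => n; apply: contrapT => no2.
    apply: no; exists n => j m hp; rewrite leqNgt; apply/negP => lt.
    by apply: no2; exists j, m; split=> //; apply: ltnW.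
  exists (L.+1%:R^-1); split; first by rewrite invr_gt0.
  right=> n _; rewrite mulrC ler_pdivrMr // -natrM ler_nat.
  apply: leq_trans (bounded_palindromes_pal 0 n hL) _.
  by apply: leq_mul => //; apply: PL_ge.
have [per|nper] := pselect (periodic_word u).
  by have [B hB] := periodic_pal_bounded per longp; apply: bounded_case hB.
have [mor [K K0 prim]] := hphi.
have fixphi : preserves_prefixes u phi by move=> n; apply: hu.1.
have [a [b [ab hab]]] : exists a b : A, a <> b /\ forall c, c = a \/ c = b.
  move: hA (enum_uniq A) (@mem_enum A A); rewrite cardE.
  case: (enum A) => [|a [|b []]] //= _; rewrite !inE andbT => /eqP ab mem.
  exists a, b; split=> // c; have := mem c.
  by rewrite !inE => /orP[] /eqP; [left|right].
pose sigma := iter K phi.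
have msig : word_morphism sigma by exact: morphism_iter.
have fsig : preserves_prefixes u sigma by exact: preserves_prefixes_iter.
have two c : (2 <= size (sigma [:: c]))%N.
  have := prim c a; have := prim c b; rewrite -/sigma.
  case: (sigma [:: c]) => [|x [|y s]] //; rewrite !inE => /eqP eb /eqP ea.
  by case: ab; rewrite ea eb.
have rec := primitive_recurrent msig fsig prim two.
pose Phi := iter 2 sigma.
have mPhi : word_morphism Phi by exact: morphism_iter.
have fPhi : preserves_prefixes u Phi by exact: preserves_prefixes_iter.
have twoPhi c : (2 <= size (Phi [:: c]))%N.
  by apply: leq_trans (iter_size_ge 2 _ msig two).
have palPhi j c : (pal (iter j Phi [:: c]) <= 2)%N.
  (* The iterate [j] of [Phi] is the square of the iterate [j] of [sigma], so the latter serves as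
     [tau] at every level. *)
  have -> : iter j Phi [:: c] = iter j sigma (iter j sigma [:: c]).
    rewrite -iterD addnn -muln2 mulnC.
    by elim: j => // j IH; rewrite mulnS /= IH.
  apply: (square_image_pal (a := a) (b := b)) => //.
  - exact: morphism_iter.
  - exact: preserves_prefixes_iter.
  - by move=> d; apply: leq_trans (iter_size_ge j _ msig two); rewrite expn_gt0.
have [M bnd] := morphism_letter_bound Phi.
(* With [J = t + 1] and [t >= 1], the bound [4 + 4 * M * J] is at most [(4 + 8 * M) * t], and
   [t * ln 2 <= ln n]. *)
exists ((4 + 8 * M)%:R / ln 2%:R); split.
  by rewrite divr_gt0 // ltr0n addn_gt0.
left=> n n2; pose t := trunc_log 2 n.
have t1 : (1 <= t)%N by apply: trunc_log_max.
have tn : (2 ^ t <= n)%N by apply: trunc_logP => //; lia.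
have nt : (n <= 2 ^ t.+1)%N by apply: ltnW; apply: trunc_log_ltn.
apply: (@le_trans _ _ ((4 + 8 * M) * t)%:R).
  rewrite ler_nat; apply: PL_le => i.
  apply: leq_trans (factor_log_pal _ mPhi fPhi twoPhi palPhi bnd nt) _.
  by nia.
rewrite natrM mulrAC ler_pdivlMr // -mulrA ler_pM2l ?ltr0n ?addn_gt0 //.
have -> : t%:R * ln 2%:R = ln ((2 ^ t)%:R : R).
  by rewrite natrX lnXn // mulr_natl.
by rewrite ler_ln ?ler_nat // posrE ltr0n ?expn_gt0 //; lia.
Qed.
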